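(* Let $q$ satisfy the RDE $dq_t=f(q_t)\,dt+\sigma(q_t)\,d\mathbf{Z}_t$, $q_0=a$, driven by a geometric rough path $\mathbf{Z}$, with rough adjoint equation $$dp_t=-\Big(\frac{\partial f}{\partial q}(q_t)\Big)^*p_t\,dt-\Big(\frac{\partial\sigma}{\partial q}(q_t)\Big)^*p_t\,d\mathbf{Z}_t,\qquad p_{t_1}=b .$$ Then the formation of the rough adjoint commutes with discretisation if the adjoint variable is solved using the cotangent lift of the discretisation for $q$. That is, if $\{q_k\}$ is generated by $q_{k+1}=\mathcal{M}_{t_k,t_{k+1},S(Z)}(q_k)$ and the adjoint equation is discretised by $p_k=T^*_{q_k}\mathcal{M}_{t_k,t_{k+1},S(Z)}(p_{k+1})$, then $\{q_k,p_k\}$ is the result of forming the adjoint $\mathcal{M}^*_{t_k,t_{k+1},S(Z)}$ of the numerical method; i.e. for the tangent sequence $\delta q_{k+1}=T_{q_k}\mathcal{M}_{t_k,t_{k+1},S(Z)}(\delta q_k)$ one has $\langle p_k,\delta q_k\rangle=\langle p_0,\delta q_0\rangle$ for all $k$.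
   Context: $\mathbf{Z}=(Z,\mathbb{Z})$ is a geometric $\alpha$-Hölder rough path in $\mathbb{R}^K$, $\alpha\in(\frac13,\frac12]$; $f\in C^\infty(\mathbb{R}^N,\mathbb{R}^N)$, $\sigma\in C^\infty(\mathbb{R}^N,\mathcal{L}(\mathbb{R}^K,\mathbb{R}^N))$; $Q=\mathbb{R}^N$; $\langle\cdot,\cdot\rangle$ is the duality (Euclidean) pairing. On a grid $\{t_k\}$, $\mathcal{M}_{t_k,t_{k+1},S(Z)}:Q\to Q$, $q_k\mapsto q_{k+1}$, denotes a one-step numerical method for the RDE that depends smoothly on the truncated signature of the rough path and on $f,\sigma$, hence is differentiable in $q_k$; $T_{q_k}\mathcal{M}_{t_k,t_{k+1},S(Z)}:T_{q_k}Q\to T_{q_{k+1}}Q$ is its tangent lift (derivative). The cotangent lift $T^*_{q_k}\mathcal{M}_{t_k,t_{k+1},S(Z)}:T^*_{q_{k+1}}Q\to T^*_{q_k}Q$ is defined by $\langle p_{k+1},T_{q_k}\mathcal{M}_{t_k,t_{k+1},S(Z)}(\delta q_k)\rangle=\langle T^*_{q_k}\mathcal{M}_{t_k,t_{k+1},S(Z)}(p_{k+1}),\delta q_k\rangle$. The adjoint of the numerical method is the numerical method $\mathcal{M}^*_{t_k,t_{k+1},S(Z)}$ applied to the adjoint variable $p_k$ such that $\langle p_k,\delta q_k\rangle=\langle p_0,\delta q_0\rangle$ holds for all $k$ (for the tangent sequences $\delta q_k$). *)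

(* Defs.v *)
From HB Require Import structures.
From mathcomp Require Import all_boot all_order all_algebra.
From mathcomp Require Import all_classical all_reals all_analysis.

Set Implicit Arguments.
Unset Strict Implicit.
Unset Printing Implicit Defensive.

Import Order.TTheory GRing.Theory Num.Theory.
Import numFieldNormedType.Exports.

Local Open Scope classical_set_scope.
Local Open Scope ring_scope.

(* Vectors of R^n are columns 'cV[R]_n, and L(R^K, R^N) is 'M[R]_(N, K). *)

Section Calculus.
Variable R : realType.

Fixpoint class_C (k : nat) (V W : normedModType R) (g : V -> W) : Prop :=
  if k is k'.+1 then
    (forall x, differentiable g x) /\
    (forall v, class_C k' (fun x => 'd g x v))
  else continuous g.

Definition smooth (V W : normedModType R) (g : V -> W) : Prop :=
  forall k, class_C k g.

Definition pairing (n : nat) (p v : 'cV[R]_n) : R := \sum_(i < n) p i 0 * v i 0.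

(* L^*, the map determined by <p, L v> = <L^* p, v>; see [dual_mapP]. *)
Definition dual_map (m n : nat) (L : 'cV[R]_m -> 'cV[R]_n) :
    'cV[R]_n -> 'cV[R]_m :=
  xget (fun=> 0) [set A | forall p v, pairing p (L v) = pairing (A p) v].

Lemma dual_mapP (m n : nat) (L : {linear 'cV[R]_m -> 'cV[R]_n}) p v :
  pairing p (L v) = pairing (dual_map L p) v.
Proof.
rewrite /dual_map; case: xgetP => [A _ /= -> //|noA]; exfalso.
apply: (noA (fun p => \col_i pairing p (L (delta_mx i 0)))) => /= {}p {}v.
have -> : L v = \sum_i v i 0 *: L (delta_mx i 0).
  rewrite [v in LHS]matrix_sum_delta linear_sum; apply: eq_bigr => i _.
  by rewrite big_ord1 linearZ.
rewrite /pairing; under eq_bigr do rewrite summxE mulr_sumr.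
rewrite exchange_big /=; apply: eq_bigr => i _.
rewrite mxE mulr_suml; apply: eq_bigr => j _.
by rewrite mxE [v i 0 * _]mulrC mulrA.
Qed.

Definition tangent_lift (m n : nat) (F : 'cV[R]_m -> 'cV[R]_n) (q : 'cV[R]_m) :
  'cV[R]_m -> 'cV[R]_n := 'd F q.

Definition cotangent_lift (m n : nat) (F : 'cV[R]_m -> 'cV[R]_n)
    (q : 'cV[R]_m) : 'cV[R]_n -> 'cV[R]_m :=
  dual_map (tangent_lift F q).

End Calculus.

Section RoughPaths.
Variables (R : realType) (K : nat) (alpha T : R).

Definition holder_path (V : normedModType R) (x : R -> V) : Prop :=
  exists C : R, forall s t, 0 <= s -> s <= t -> t <= T ->
    `|x t - x s| <= C * (t - s) `^ alpha.

(* ZZ s t i j stands for the iterated integral of (Z^i - Z^i_s) against dZ^j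
   over [s, t]. *)
Definition rough_path (Z : R -> 'cV[R]_K) (ZZ : R -> R -> 'M[R]_K) : Prop :=
  [/\ holder_path Z,
      exists C : R, forall s t, 0 <= s -> s <= t -> t <= T ->
        `|ZZ s t| <= C * (t - s) `^ (2 * alpha)
    & forall s u t, 0 <= s -> s <= u -> u <= t -> t <= T ->
        ZZ s t - ZZ s u - ZZ u t = (Z u - Z s) *m (Z t - Z u)^T].

Definition canonical_lift (z : R -> 'cV[R]_K) (s t : R) : 'M[R]_K :=
  \matrix_(i, j) \int[lebesgue_measure]_(r in `[s, t])
     ((z r i 0 - z s i 0) * derive1 (fun u => z u j 0) r).

(* Closure of the canonical lifts of smooth paths in the alpha-Hoelder rough
   path topology. *)
Definition geometric_rough_path
    (Z : R -> 'cV[R]_K) (ZZ : R -> R -> 'M[R]_K) : Prop :=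
  rough_path Z ZZ /\
  forall eps : R, 0 < eps -> exists2 z : R -> 'cV[R]_K, smooth z &
    forall s t, 0 <= s -> s <= t -> t <= T ->
      `|(Z t - Z s) - (z t - z s)| <= eps * (t - s) `^ alpha /\
      `|ZZ s t - canonical_lift z s t| <= eps * (t - s) `^ (2 * alpha).

(* Elements of the tensor algebra over R^K truncated at level n, given by their
   coordinates on the words of length at most n. *)
Definition truncated_tensor (n : nat) : Type := n.-bseq 'I_K -> R.

Definition tensor_mul (n : nat) (X Y : truncated_tensor n) :
    truncated_tensor n :=
  fun w => \sum_(uv : n.-bseq 'I_K * n.-bseq 'I_K
                  | uv.1 ++ uv.2 == w :> seq 'I_K) X uv.1 * Y uv.2.

(* The Lyons extension of (Z, ZZ) to level n. *)
Definition truncated_signature (n : nat) (Z : R -> 'cV[R]_K)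
    (ZZ : R -> R -> 'M[R]_K) (S : R -> R -> truncated_tensor n) : Prop :=
  [/\ forall s t (w : n.-bseq 'I_K), 0 <= s -> s <= t -> t <= T ->
        [/\ w = [::] :> seq 'I_K -> S s t w = 1,
            forall i, w = [:: i] :> seq 'I_K -> S s t w = Z t i 0 - Z s i 0
          & forall i j, w = [:: i; j] :> seq 'I_K -> S s t w = ZZ s t i j],
      forall s u t, 0 <= s -> s <= u -> u <= t -> t <= T ->
        S s t =1 tensor_mul (S s u) (S u t)
    & exists C : R, forall s t (w : n.-bseq 'I_K),
        0 <= s -> s <= t -> t <= T ->
        `|S s t w| <= C * (t - s) `^ ((size w)%:R * alpha)].

Definition controlled_path (m : nat) (Z : R -> 'cV[R]_K)
    (Y : R -> 'cV[R]_m) (Y' : R -> 'M[R]_(m, K)) : Prop :=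
  [/\ holder_path Y, holder_path Y'
    & exists C : R, forall s t, 0 <= s -> s <= t -> t <= T ->
        `|Y t - Y s - Y' s *m (Z t - Z s)| <= C * (t - s) `^ (2 * alpha)].

(* The integrand Y is L(R^K, R^m)-valued; Y' s i is its Gubinelli derivative in
   the i-th direction of R^K, so that the second-order term is
   \sum_(i, j) ZZ^{ij} Y' s i e_j. *)
Definition compensated_sum (m : nat) (Z : R -> 'cV[R]_K)
    (ZZ : R -> R -> 'M[R]_K) (Y : R -> 'M[R]_(m, K))
    (Y' : R -> 'I_K -> 'M[R]_(m, K)) (a : R) (P : seq R) : 'cV[R]_m :=
  \sum_(0 <= l < size P)
    let u := nth a (a :: P) l in let v := nth a P l in
    (Y u *m (Z v - Z u) + \sum_(i < K) Y' u i *m (row i (ZZ u v))^T).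

Definition is_rough_integral (m : nat) (Z : R -> 'cV[R]_K)
    (ZZ : R -> R -> 'M[R]_K) (Y : R -> 'M[R]_(m, K))
    (Y' : R -> 'I_K -> 'M[R]_(m, K)) (a b : R) (I : 'cV[R]_m) : Prop :=
  forall eps : R, 0 < eps -> exists2 delta : R, 0 < delta &
    forall P : seq R, itv_partition a b P ->
      (forall l, (l < size P)%N -> nth a P l - nth a (a :: P) l < delta) ->
      `|compensated_sum Z ZZ Y Y' a P - I| < eps.

(* dx = f(x) dt + sigma(x) d(Z, ZZ) on [0, T]: (x, sigma(x)) is controlled by Z
   and the integral equation holds, with sigma(x) integrated as the controlled
   path whose Gubinelli derivative is D sigma(x) sigma(x). *)
Definition rde_solution (m : nat) (Z : R -> 'cV[R]_K)
    (ZZ : R -> R -> 'M[R]_K) (f : 'cV[R]_m -> 'cV[R]_m)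
    (sigma : 'cV[R]_m -> 'M[R]_(m, K)) (x : R -> 'cV[R]_m) : Prop :=
  controlled_path Z x (fun t => sigma (x t)) /\
  forall t, 0 <= t -> t <= T ->
    is_rough_integral Z ZZ (fun s => sigma (x s))
      (fun s i => 'd sigma (x s) (col i (sigma (x s)))) 0 t
      (x t - x 0 -
       \col_i \int[lebesgue_measure]_(s in `[0, t]) f (x s) i 0).

End RoughPaths.

Section Adjoint.
Variables (R : realType) (K N : nat).

(* Vector fields of the system satisfied by (q, p), where
   dp = - (Df(q))^* p dt - (D sigma(q))^* p dZ; the j-th column of
   (D sigma(q))^* p is (D sigma_j(q))^* p, sigma_j being the j-th column of
   sigma. *)
Definition adjoint_drift (f : 'cV[R]_N -> 'cV[R]_N) (x : 'cV[R]_(N + N)) :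
    'cV[R]_(N + N) :=
  let q := usubmx x in let p := dsubmx x in
  col_mx (f q) (- dual_map ('d f q) p).

Definition adjoint_diffusion (sigma : 'cV[R]_N -> 'M[R]_(N, K))
    (x : 'cV[R]_(N + N)) : 'M[R]_(N + N, K) :=
  let q := usubmx x in let p := dsubmx x in
  col_mx (sigma q)
    (- \matrix_(i, j) dual_map ('d (fun y => col j (sigma y)) q) p i 0).

Definition adjoint_rde_solution (alpha T : R) (Z : R -> 'cV[R]_K)
    (ZZ : R -> R -> 'M[R]_K) (f : 'cV[R]_N -> 'cV[R]_N)
    (sigma : 'cV[R]_N -> 'M[R]_(N, K)) (q p : R -> 'cV[R]_N) : Prop :=
  rde_solution alpha T Z ZZ (adjoint_drift f) (adjoint_diffusion sigma)
    (fun t => col_mx (q t) (p t)).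

End Adjoint.

Section NumericalMethods.
Variables (R : realType) (K N n : nat).

(* Phi f sigma s t X q is one step from time s to time t started at q, X being
   the truncated signature over [s, t]. *)
Definition step_map : Type :=
  ('cV[R]_N -> 'cV[R]_N) -> ('cV[R]_N -> 'M[R]_(N, K)) ->
  R -> R -> truncated_tensor R K n -> 'cV[R]_N -> 'cV[R]_N.

(* Joint smoothness in (f, sigma, X, q).  As f and sigma range over spaces of
   smooth maps, it is expressed along smooth finite-dimensional families: Phi
   sends smooth families of data to smooth families of points. *)
Definition smooth_step (Phi : step_map) : Prop :=
  forall (m : nat) (F : 'cV[R]_m -> 'cV[R]_N -> 'cV[R]_N)
    (Sigma : 'cV[R]_m -> 'cV[R]_N -> 'M[R]_(N, K))
    (X : 'cV[R]_m -> truncated_tensor R K n) (x : 'cV[R]_m -> 'cV[R]_N),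
    smooth (fun y : 'cV[R]_m * 'cV[R]_N => F y.1 y.2) ->
    smooth (fun y : 'cV[R]_m * 'cV[R]_N => Sigma y.1 y.2) ->
    (forall w, smooth (fun theta => X theta w : R^o)) ->
    smooth x ->
    forall s t : R, s < t ->
      smooth (fun theta => Phi (F theta) (Sigma theta) s t (X theta) (x theta)).

Definition tangent_sequence (M : nat -> 'cV[R]_N -> 'cV[R]_N) (L : nat)
    (q dq : nat -> 'cV[R]_N) : Prop :=
  forall k, (k < L)%N -> dq k.+1 = tangent_lift (M k) (q k) (dq k).

(* (q_k, p_k) for k = 0, ..., L is the result of forming the adjoint of the
   method whose k-th step is M k. *)
Definition adjoint_of_method (M : nat -> 'cV[R]_N -> 'cV[R]_N) (L : nat)
    (q p : nat -> 'cV[R]_N) : Prop :=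
  (forall k, (k < L)%N -> q k.+1 = M k (q k)) /\
  (forall dq, tangent_sequence M L q dq ->
     forall k, (k <= L)%N -> pairing (p k) (dq k) = pairing (p 0%N) (dq 0%N)).

End NumericalMethods.

(* Main.v *)
Require Import Defs.
From HB Require Import structures.
From mathcomp Require Import all_boot all_order all_algebra.
From mathcomp Require Import all_classical all_reals all_analysis.

Import Order.TTheory GRing.Theory Num.Theory.
Import numFieldNormedType.Exports.
Local Open Scope classical_set_scope.
Local Open Scope ring_scope.

(** The cotangent lift of a step is by definition the transpose of its tangent
    lift, so the pairing of an adjoint vector with a tangent vector takes the
    same value at both ends of the step ([pairing_step]).  Pulling p back by the
    transpose while pushing dq forward by the derivative therefore leaves
    <p_k, dq_k> unchanged from one grid point to the next, and induction on k
    gives <p_k, dq_k> = <p_0, dq_0> ([adjoint_of_cotangent_lift]). *)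

(** The transpose exists because ['d F q] is a linear map between
    finite-dimensional spaces. *)
Lemma pairing_step (R : realType) (m n : nat) (F : 'cV[R]_m -> 'cV[R]_n)
    (q v : 'cV[R]_m) (p : 'cV[R]_n) :
  pairing p (tangent_lift F q v) = pairing (cotangent_lift F q p) v.
Proof. exact: dual_mapP. Qed.

Lemma adjoint_of_cotangent_lift (R : realType) (N : nat)
    (M : nat -> 'cV[R]_N -> 'cV[R]_N) (L : nat) (q p : nat -> 'cV[R]_N) :
  (forall k, (k < L)%N -> q k.+1 = M k (q k)) ->
  (forall k, (k < L)%N -> p k = cotangent_lift (M k) (q k) (p k.+1)) ->
  adjoint_of_method M L q p.
Proof.
move=> qM pM; split=> // dq dqM; elim=> [//|k IHk] ltkL.
by rewrite dqM // pairing_step -pM // IHk // ltnW.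
Qed.

Theorem proposition3p8 (R : realType) (K N : nat) (alpha T : R)
    (halpha : 3^-1 < alpha /\ alpha <= 2^-1) (hT : 0 < T)
    (* the driving geometric rough path *)
    (Z : R -> 'cV[R]_K) (ZZ : R -> R -> 'M[R]_K)
    (hZ : geometric_rough_path alpha T Z ZZ)
    (f : 'cV[R]_N -> 'cV[R]_N) (sigma : 'cV[R]_N -> 'M[R]_(N, K))
    (hf : smooth f) (hsigma : smooth sigma)
    (* the RDE and its rough adjoint *)
    (a b : 'cV[R]_N) (q p : R -> 'cV[R]_N)
    (hq : rde_solution alpha T Z ZZ f sigma q) (hq0 : q 0 = a)
    (hp : adjoint_rde_solution alpha T Z ZZ f sigma q p) (hpT : p T = b)
    (* the grid and the numerical method *)
    (L : nat) (tau : nat -> R)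
    (htau0 : 0 <= tau 0%N) (htauL : tau L <= T)
    (htau : forall k, (k < L)%N -> tau k < tau k.+1)
    (n : nat) (S : R -> R -> truncated_tensor R K n)
    (hS : truncated_signature alpha T Z ZZ S)
    (Phi : step_map R K N n) (hPhi : smooth_step Phi) :
  let M := fun k => Phi f sigma (tau k) (tau k.+1) (S (tau k) (tau k.+1)) in
  forall qd pd : nat -> 'cV[R]_N,
    (forall k, (k < L)%N -> qd k.+1 = M k (qd k)) ->
    (forall k, (k < L)%N -> pd k = cotangent_lift (M k) (qd k) (pd k.+1)) ->
    adjoint_of_method M L qd pd.
Proof. by move=> M qd pd; exact: adjoint_of_cotangent_lift. Qed.
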